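(* Assume that $X[\mathcal{T}]$ is a locally convex topological vector space; $\mathcal{C}$ is a non-decreasing countable localizing family in $X$; each member of $\mathcal{C}$ is absolutely convex and $\mathcal{T}$-closed; and a subset of $X$ is $\mathcal{T}_{\mathcal{C}}$-bounded if and only if it is contained in some $C\in\mathcal{C}$. The following are equivalent. (A) Each member of $\mathcal{C}$ is $\mathcal{T}$-compact. (B) $X[\mathcal{T}_{\mathcal{C}}]$ is semireflexive and the evaluation map $\mathrm{ev}:X\to X^{**}$ is a $(\mathcal{T}_{\mathcal{C}},\sigma_{\mathrm{bd}}(X^{**},X^* ))$-homeomorphism.
   Context: All vector spaces are real; topological vector spaces are Hausdorff. $X[\mathcal{T}]$ denotes $X$ equipped with the topology $\mathcal{T}$; $\mathcal{T}|_C=\{E\cap C:E\in\mathcal{T}\}$. A set is absolutely convex if it is convex and balanced. A localizing family in a vector space $X$ is a non-empty collection $\mathcal{C}$ of convex subsets of $X$ containing $0$ such that for all $C\in\mathcal{C}$, $x\in X$, $t\in\mathbb{R}$ there is $D\in\mathcal{C}$ with $x+t\cdot C\subseteq D$. It is non-decreasing countable if it can be numbered $\mathcal{C}=\{C_k:k\in\mathbb{N}\}$ with $C_k\subseteq C_{k+1}$ for all $k$. Given a locally convex topology $\mathcal{T}$ on $X$ and a localizing family $\mathcal{C}$, the localization $\mathcal{T}_{\mathcal{C}}$ is the locally convex vector topology on $X$ consisting of all $E\subseteq X$ such that for every $x\in E$ there is a convex $V$ with $x\in V\subseteq E$ and $V\cap C\in\mathcal{T}|_C$ for every $C\in\mathcal{C}$.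 $X^*=X[\mathcal{T}_{\mathcal{C}}]^*$ is the space of $\mathcal{T}_{\mathcal{C}}$-continuous linear forms, equipped with the strong topology $\beta(X^*,X)$ (uniform convergence on $\mathcal{T}_{\mathcal{C}}$-bounded subsets of $X$). $X^{**}=X^*[\beta(X^*,X)]^*$. The evaluation map is $\mathrm{ev}(x)(x^* )=x^*(x)$; it is a well-defined injective linear map $X\to X^{**}$, and $X[\mathcal{T}_{\mathcal{C}}]$ is semireflexive if $\mathrm{ev}$ is surjective. Bounded weak* topology: for a locally convex space $Y$ with local base (at $0$) $\mathcal{B}$, the polars $U^\circ=\{y^*\in Y^*:|\langle y,y^*\rangle|\le1\ \forall y\in U\}$, $U\in\mathcal{B}$, form a localizing family $\mathcal{B}^\circ$ in $Y^*$; $\sigma_{\mathrm{bd}}(Y^*,Y)$ is the localization of the weak* topology $\sigma(Y^*,Y)$ by $\mathcal{B}^\circ$ (independent of the choice of $\mathcal{B}$). Here it is applied with $Y=X^*[\beta(X^*,X)]$. *)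

(* Defs.v *)
From HB Require Import structures.
From mathcomp Require Import all_boot all_order all_algebra.
From mathcomp Require Import all_classical all_reals.
From mathcomp Require Import interval_inference topology normedtype convex.

Set Implicit Arguments.
Unset Strict Implicit.
Unset Printing Implicit Defensive.

Import Order.TTheory GRing.Theory Num.Theory.
Import numFieldTopology.Exports numFieldNormedType.Exports.
Local Open Scope classical_set_scope.
Local Open Scope ring_scope.

Definition balanced (R : realType) (X : lmodType R) (A : set X) :=
  forall (t : R) x, `|t| <= 1 -> A x -> A (t *: x).

Definition absolutely_convex (R : realType) (X : lmodType R) (A : set X) :=
  convex_set A /\ balanced A.

(* The library's [bounded_set] is norm-boundedness; in a topological vector
   space, a set is bounded if every neighborhood of 0 absorbs it. *)
Definition tvs_bounded (R : realType) (X : preTopologicalLmodType R)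
    (A : set X) :=
  forall U, nbhs (0 : X) U ->
    \forall r \near +oo, A `<=` [set (r : R) *: u | u in U].

Definition homeomorphism (T U : topologicalType) (f : T -> U) :=
  exists g : U -> T, [/\ cancel f g, cancel g f, continuous f & continuous g].

Definition localizing (R : realType) (X : lmodType R) (C : set_system X) :=
  [/\ C !=set0,
      forall D, C D -> convex_set D /\ D 0 &
      forall D x (t : R), C D ->
        exists2 D', C D' & [set x + t *: y | y in D] `<=` D'].

Record localizing_family (R : realType) (X : lmodType R) := LocalizingFamily {
  lf_sets :> set_system X;
  lf_localizing : localizing lf_sets }.

Definition nondecreasing_countable (T : Type) (C : set_system T) :=
  exists Ck : nat -> set T,
    C = range Ck /\ forall k, Ck k `<=` Ck k.+1.

(* [V `&` D] belongs to the topology that D inherits from X, for all D in C. *)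
Definition relatively_open (X : topologicalType) (C : set_system X)
    (V : set X) :=
  forall D, C D -> exists2 O, open O & V `&` D = O `&` D.

Definition localized_open (R : realType) (X : preTopologicalLmodType R)
    (C : set_system X) : set_system X :=
  [set E | forall x, E x -> exists V : set X,
    [/\ convex_set V, V x, V `<=` E & relatively_open C V]].

(* A copy of X, carrying the localization by C of the topology of X.  It is a
   topology for any C, and a locally convex vector topology if X is a locally
   convex space and C a localizing family. *)
Definition localization (R : realType) (X : preTopologicalLmodType R)
  (C : set_system X) : Type := X.

Section localization_topology.
Context (R : realType) (X : preTopologicalLmodType R) (C : set_system X).

Lemma localized_openT : localized_open C setT.
Proof.
move=> x _; exists setT; split=> //.
by move=> D _; exists setT => //; exact: openT.
Qed.

Lemma convex_setI (A B : set X) :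
  convex_set A -> convex_set B -> convex_set (A `&` B).
Proof.
move=> cA cB x y l; rewrite !inE => -[Ax Bx] [Ay By].
by split; apply/set_mem; [apply: cA|apply: cB]; rewrite inE.
Qed.

Lemma relatively_openI (A B : set X) :
  relatively_open C A -> relatively_open C B -> relatively_open C (A `&` B).
Proof.
move=> oA oB D CD; have [O oO AO] := oA D CD; have [P oP BP] := oB D CD.
by exists (O `&` P); [exact: openI|rewrite [LHS]setIIl AO BP -setIIl].
Qed.

Lemma localized_openI : setI_closed (localized_open C).
Proof.
move=> A B oA oB x [/oA[V [cV Vx VA oV]] /oB[W [cW Wx WB oW]]].
exists (V `&` W); split=> //; first exact: convex_setI.
- exact: setISS.
- exact: relatively_openI.
Qed.

Lemma localized_open_bigU (I : Type) (f : I -> set X) :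
  (forall i, localized_open C (f i)) -> localized_open C (\bigcup_i f i).
Proof.
move=> of_ x [i _ /(of_ i)[V [cV Vx Vf oV]]]; exists V; split=> //.
by move=> y /Vf; exists i.
Qed.

HB.instance Definition _ := GRing.Lmodule.copy (localization C) X.
HB.instance Definition _ :=
  isOpenTopological.Build (localization C)
    localized_openT localized_openI localized_open_bigU.

Lemma localization_openE :
  (open : set_system (localization C)) = localized_open C.
Proof. by []. Qed.

End localization_topology.

Section tvs_of_topological.
Context (R : realType) (E : preTopologicalLmodType R)
  (addE : continuous (fun x : E * E => x.1 + x.2))
  (scaleE : continuous (fun z : R^o * E => z.1 *: z.2))
  (convexE : exists2 B : set_system E,
    (forall b, b \in B -> convex_set b) & basis B).

Definition tvs_of_topological : Type := E.
Local Notation E' := tvs_of_topological.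

HB.instance Definition _ := PreTopologicalLmodule.copy E' E.
HB.instance Definition _ :=
  PreTopologicalNmodule_isTopologicalNmodule.Build E' addE.
HB.instance Definition _ :=
  TopologicalNmodule_isTopologicalLmodule.Build R E' scaleE.
HB.instance Definition _ :=
  PreTopologicalLmod_isTvs.Build R E' addE scaleE convexE.
HB.instance Definition _ := Uniform_isTvs.Build R E' convexE.

Definition tvs_of_topological_tvs : tvsType R := E'.

End tvs_of_topological.

Section localization_tvs.
Context (R : realType) (X : tvsType R) (C : localizing_family X).
Local Notation XC := (localization C).

Lemma convex_setP (Y : lmodType R) (A : set Y) : convex_set A <->
  forall x y (l : R), 0 <= l -> l <= 1 -> A x -> A y ->
    A (l *: x + (1 - l) *: y).
Proof.
split=> [cA x y l l0 l1 Ax Ay|cA x y l /set_mem Ax /set_mem Ay].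
  by apply/set_mem; apply: (cA x y (Itv01 l0 l1)); rewrite inE.
by rewrite inE; apply: cA.
Qed.

Lemma convex_half (A : set X) (x y : X) : convex_set A -> A (2 *: x) ->
  A (2 *: y) -> A (x + y).
Proof.
move=> /convex_setP cA Ax Ay.
have := cA _ _ 2^-1 _ _ Ax Ay; rewrite !scalerA.
have -> : (1 - 2^-1) * 2 = 1 :> R by rewrite mulrBl mul1r mulVf// addrK.
by rewrite mulVf// !scale1r; apply; rewrite ?invf_le1 ?ler1n.
Qed.

Lemma convex_affine (A : set X) (a : X) (t : R) : convex_set A ->
  convex_set [set x : X | A (a + t *: x)].
Proof.
move=> /convex_setP cA; apply/convex_setP => x y l l0 l1 /= Ax Ay.
have := cA _ _ l l0 l1 Ax Ay; congr (A _).
rewrite !scalerDr addrACA -scalerDl [l + _]addrC subrK scale1r !scalerA.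
by rewrite mulrC [(1 - l) * t]mulrC.
Qed.

Lemma affine_continuous (a : X) (t : R) : continuous (fun x : X => a + t *: x).
Proof.
move=> x; apply: (@continuous_comp _ (X * X)%type _ (fun x => (a, t *: x))
  (fun x => x.1 + x.2)); last exact: add_continuous.
apply: cvg_pair; first exact: cvg_cst.
apply: (@continuous_comp _ (R^o * X)%type _ (fun x => (t : R^o, x))
  (fun x => x.1 *: x.2)); last exact: scale_continuous.
by apply: (@cvg_pair _ _ _ _ (nbhs (t : R^o))); [exact: cvg_cst|exact: cvg_id].
Qed.

Lemma relatively_open_affine (A : set X) (a : X) (t : R) :
  relatively_open C A -> relatively_open C [set x | A (a + t *: x)].
Proof.
move=> oA D CD; have [_ _ /(_ D a t CD)[D' CD' DD']] := lf_localizing C.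
have [O oO AO] := oA D' CD'.
exists ((fun x => a + t *: x) @^-1` O).
  by apply: open_comp => // x _; exact: affine_continuous.
apply/seteqP; split=> x [/= + Dx]; (have D'x : D' (a + t *: x) by
  apply: DD'; exists x) => h; split=> //.
- by have [] : (O `&` D') (a + t *: x) by rewrite -AO.
- by have [] : (A `&` D') (a + t *: x) by rewrite AO.
Qed.

Lemma nbhs_localization (x : X) (A V : set X) : convex_set V -> V x ->
  relatively_open C V -> V `<=` A -> nbhs (x : XC) A.
Proof.
by move=> cV Vx oV VA; exists V; split=> //; move=> y Vy; exists V; split=> //.
Qed.

Lemma relatively_open_absorbs (V : set X) (x : X) : V 0 ->
  relatively_open C V ->
  \forall r \near (0 : R), V (r *: x).
Proof.
move=> V0 oV; have [[D0 CD0] Cc Ca] := lf_localizing C.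
have [D1 CD1 D01] := Ca D0 x 0 CD0.
have D1x : D1 x.
  by apply: D01; exists 0; [case: (Cc _ CD0)|rewrite scaler0 addr0].
have [D2 CD2 D12] := Ca D1 (- x) 2 CD1.
have D2Nx : D2 (- x).
  by apply: D12; exists 0; [case: (Cc _ CD1)|rewrite scaler0 addr0].
have D2x : D2 x.
  apply: D12; exists x => //.
  by rewrite scaler_nat mulr2n addKr.
have /convex_setP cD2 := (Cc _ CD2).1.
have [O oO VO] := oV D2 CD2.
have O0 : O 0 by have [] : (O `&` D2) 0 by rewrite -VO; split=> //; exact: (Cc _ CD2).2.
have nO : nbhs (0 : X) O by exact: open_nbhs_nbhs.
have : continuous_at (0 : R^o) (fun r : R^o => r *: x).
  apply: (@continuous_comp _ (R^o * X)%type _ (fun r => (r, x))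
    (fun z => z.1 *: z.2)); last exact: scale_continuous.
  by apply: (@cvg_pair _ _ _ _ (nbhs (0 : R^o))); [exact: cvg_id|exact: cvg_cst].
rewrite /continuous_at scale0r => /(_ _ nO) /= h.
near=> r.
suff [] : (V `&` D2) (r *: x) by [].
rewrite VO; split; first by near: r; exact: h.
have r1 : `|r| <= 1.
  near: r; apply/nbhs_normP; exists 1 => [|z]; first exact: ltr01.
  by rewrite /= sub0r normrN => /ltW.
rewrite ler_norml in r1; have /andP[r1m r1p] := r1.
have -> : r *: x = ((1 + r) / 2) *: x + (1 - (1 + r) / 2) *: - x.
  rewrite scalerN -scalerBl; congr (_ *: _).
  by rewrite opprB addrA -splitr addrAC subrr add0r.
apply: cD2 => //.
- by rewrite divr_ge0// -lerBlDl sub0r.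
- by rewrite ler_pdivrMr// mul1r lerD2l.
Unshelve. all: by end_near. Qed.

Lemma localization_add : continuous (fun x : XC * XC => x.1 + x.2).
Proof.
move=> [x y] U /= [E [oE Exy EU]].
have [V [cV Vxy VE oV]] := oE _ Exy.
exists ([set z | V ((y - x) + 2 *: (z : X))],
        [set w | V ((x - y) + 2 *: (w : X))]) => /=.
  split; (apply: nbhs_localization; last exact: subset_refl);
    try exact: convex_affine; try exact: relatively_open_affine.
  - by rewrite /= scaler_nat mulr2n addrA subrK addrC.
  - by rewrite /= scaler_nat mulr2n addrA subrK.
move=> [z w] /= [Vz Vw]; apply/EU/VE.
have -> : z + w = (2^-1 *: ((y - x) + 2 *: (z : X))) +
                  (2^-1 *: ((x - y) + 2 *: (w : X))) :> X.
  rewrite -scalerDr addrACA -scalerDr -[y - x]opprB addNr add0r scalerA.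
  by rewrite mulVf// scale1r.
by apply: convex_half => //; rewrite scalerA mulfV// scale1r.
Qed.

Lemma localization_scale : continuous (fun z : R^o * XC => z.1 *: z.2).
Proof.
move=> [t x] U /= [E [oE Etx EU]].
have [V [cV Vtx VE oV]] := oE _ Etx.
pose V0 := [set v : X | V (t *: (x : X) + 1 *: v)].
have cV0 : convex_set V0 by exact: convex_affine.
have oV0 : relatively_open C V0 by exact: relatively_open_affine.
have V00 : V0 0 by rewrite /V0/= scaler0 addr0.
have V0x := @relatively_open_absorbs V0 (4 *: (x : X)) V00 oV0.
pose W := [set z : X | V0 (- (4 *: (x : X)) + 4 *: z)] `&`
          [set z : X | V0 (4 *: (x : X) + (-4) *: z)].
pose A := [set z : X | V (- (t *: (x : X)) + (2 * t) *: z)].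
have cA : convex_set A by exact: convex_affine.
have oA : relatively_open C A by exact: relatively_open_affine.
have cW : convex_set W by apply: convex_setI; exact: convex_affine.
have oW : relatively_open C W.
  by apply: relatively_openI; exact: relatively_open_affine.
exists ([set s : R^o | `|s - t| <= 1 /\ V0 ((s - t) *: (4 *: (x : X)))],
        A `&` W) => /=.
  split.
    apply: filterI.
      apply/nbhs_normP; exists 1 => //= s; rewrite distrC; exact: ltW.
    have : (fun s : R => s - t) @ t --> (0 : R).
      rewrite -[0](subrr t); apply: cvgB; [exact: cvg_id|exact: cvg_cst].
    by move=> /(_ _ V0x).
  apply: nbhs_localization; last exact: subset_refl.
  - exact: convex_setI.
  - split; first by rewrite /A/= -scalerA scaler_nat mulr2n addKr.
    split; first by rewrite /= addNr.
    by rewrite /= scaleNr subrr.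
  - exact: relatively_openI.
move=> [s z] /= [[s1 V0s] [Az [W1 W2]]]; apply/EU/VE.
have -> : s *: z = t *: (z : X) - 2^-1 *: (t *: (x : X)) +
                   ((s - t) *: (z : X) + 2^-1 *: (t *: (x : X))) :> X.
  by rewrite addrACA addNr addr0 -scalerDl addrC subrK.
apply: convex_half => //.
  by move: Az; rewrite /A/= scalerDr scalerN !scalerA mulfV// mul1r addrC.
suff : V0 (2 *: ((s - t) *: (z : X))).
  by rewrite /V0/= scale1r addrC scalerDr [2 *: (2^-1 *: _)]scalerA mulfV// scale1r.
have -> : 2 *: ((s - t) *: (z : X)) =
  2 *: ((s - t) *: (x : X)) + 2 *: ((s - t) *: ((z : X) - x)).
  by rewrite -scalerDr -scalerDr subrKC.
have two2 (u : X) : 2 *: (2 *: ((s - t) *: u)) = (s - t) *: (4 *: u).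
  by rewrite !scalerA -natrM mulrC.
apply: convex_half => //; first by rewrite two2.
have W1' : V0 (4 *: ((z : X) - x)) by rewrite scalerBr addrC.
have W2' : V0 (- (4 *: ((z : X) - x))).
  by rewrite -scalerN opprB scalerBr -scaleNr.
rewrite two2.
have [st0|st0] := leP 0 (s - t).
  have /convex_setP/(_ _ _ (s - t) st0 _ W1' V00) := cV0.
  rewrite scaler0 addr0; apply.
  by rewrite ger0_norm in s1.
have /convex_setP/(_ _ _ (- (s - t)) _ _ W2' V00) := cV0.
rewrite scaler0 addr0 scalerN scaleNr opprK; apply.
  by rewrite oppr_ge0 ltW.
by rewrite ltr0_norm in s1.
Qed.

Lemma localization_convex :
  exists2 B : set_system XC, (forall b, b \in B -> convex_set b) & basis B.
Proof.
exists [set V : set X | convex_set V /\ relatively_open C V].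
  by move=> b /set_mem[].
split.
  move=> V [cV oV].
  by rewrite localization_openE => x Vx; exists V; split.
move=> x A [E [oE Ex EA]]; have [V [cV Vx VE oV]] := oE _ Ex.
exists V; first by split.
exact: subset_trans EA.
Qed.

(* Not an HB.instance: [localization C] unfolds to X, so that HB would find the
   structures of X and generate nothing. *)
Canonical localization_tvsType : tvsType R := @Tvs.Pack R XC
  (Tvs.class (tvs_of_topological_tvs
    localization_add localization_scale localization_convex)).

End localization_tvs.

Definition continuous_form (R : realType) (Y : preTopologicalLmodType R) :
    {pred (Y -> R^o)} :=
  fun f => `[< linear f /\ continuous f >].

Record dual (R : realType) (Y : preTopologicalLmodType R) := Dual {
  dual_fun :> Y -> R^o;
  dual_funP : dual_fun \in @continuous_form R Y }.

Section dual_lmodule.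
Context (R : realType) (Y : preTopologicalLmodType R).

Lemma continuous_form_closed : submod_closed (@continuous_form R Y).
Proof.
split=> [|a f g /asboolP[lf cf] /asboolP[lg cg]].
  apply/asboolP; split; last by move=> x; exact: cvg_cst.
  by move=> a x y /=; rewrite /GRing.zero/= scaler0 addr0.
apply/asboolP; split.
  move=> b x y.
  change (a *: f (b *: x + y) + g (b *: x + y) =
    b *: (a *: f x + g x) + (a *: f y + g y)).
  by rewrite lf lg !scalerDr addrACA !scalerA mulrC.
move=> x; change ((fun y => a *: f y + g y) @ x --> a *: f x + g x).
by apply: cvgD; [apply: cvgZl_tmp; exact: cf|exact: cg].
Qed.

HB.instance Definition _ := GRing.isSubmodClosed.Build R (Y -> R^o)
  (@continuous_form R Y) continuous_form_closed.
HB.instance Definition _ := [isSub for @dual_fun R Y].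
HB.instance Definition _ := [Choice of dual Y by <:].
HB.instance Definition _ := [SubChoice_isSubLmodule of dual Y by <:].

End dual_lmodule.

(* A copy of the dual, with the topology of uniform convergence on bounded
   sets. *)
Definition strong_dual (R : realType) (Y : preTopologicalLmodType R) : Type :=
  initial_topology
    (@dual_fun R Y : dual Y -> {family @tvs_bounded R Y, Y -> R^o}).

HB.instance Definition _ (R : realType) (Y : preTopologicalLmodType R) :=
  GRing.Lmodule.copy (strong_dual Y) (dual Y).
HB.instance Definition _ (R : realType) (Y : preTopologicalLmodType R) :=
  Topological.copy (strong_dual Y) (initial_topology
    (@dual_fun R Y : dual Y -> {family @tvs_bounded R Y, Y -> R^o})).

(* A copy of the dual, with the topology of pointwise convergence. *)
Definition weak_star_dual (R : realType) (Y : preTopologicalLmodType R) :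
    Type :=
  initial_topology (@dual_fun R Y : dual Y -> {ptws Y -> R^o}).

HB.instance Definition _ (R : realType) (Y : preTopologicalLmodType R) :=
  GRing.Lmodule.copy (weak_star_dual Y) (dual Y).
HB.instance Definition _ (R : realType) (Y : preTopologicalLmodType R) :=
  Topological.copy (weak_star_dual Y)
    (initial_topology (@dual_fun R Y : dual Y -> {ptws Y -> R^o})).

Definition polar (R : realType) (Y : preTopologicalLmodType R) (U : set Y) :
    set (dual Y) :=
  [set f | forall y, U y -> `|f y| <= 1].

(* The localization of the weak* topology by the polars of a local base of Y,
   here all neighborhoods of 0; the topology does not depend on the base. *)
Definition bounded_weak_star_dual (R : realType)
    (Y : preTopologicalLmodType R) : Type :=
  @localization R (weak_star_dual Y) [set polar U | U in nbhs (0 : Y)].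

HB.instance Definition _ (R : realType) (Y : preTopologicalLmodType R) :=
  GRing.Lmodule.copy (bounded_weak_star_dual Y) (dual Y).
HB.instance Definition _ (R : realType) (Y : preTopologicalLmodType R) :=
  Topological.copy (bounded_weak_star_dual Y)
    (@localization R (weak_star_dual Y) [set polar U | U in nbhs (0 : Y)]).

Section evaluation.
Context (R : realType) (Y : tvsType R).

Lemma tvs_bounded1 (x : Y) : tvs_bounded [set x].
Proof.
move=> U U0.
have : continuous_at (0 : R^o) (fun r : R^o => r *: x).
  apply: (@continuous_comp _ (R^o * Y)%type _ (fun r => (r, x))
    (fun z => z.1 *: z.2)); last exact: scale_continuous.
  by apply: (@cvg_pair _ _ _ _ (nbhs (0 : R^o))); [exact: cvg_id|exact: cvg_cst].
rewrite /continuous_at scale0r => /(_ _ U0) /nbhs_normP[e /= e0 eU].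
near=> r => _ ->; have r0 : 0 < r by [].
exists (r^-1 *: x); last by rewrite scalerA mulfV ?gt_eqF// scale1r.
apply: eU => /=; rewrite sub0r normrN gtr0_norm ?invr_gt0//.
rewrite invf_plt ?posrE//; near: r; exact/nbhs_pinfty_gt/num_real.
Unshelve. all: by end_near. Qed.

Lemma ev_proof (x : Y) :
  (fun f : strong_dual Y => dual_fun f x) \in @continuous_form R (strong_dual Y).
Proof.
apply/asboolP; split; first by [].
pose F := {family @tvs_bounded R Y, Y -> R^o}.
have cdual : continuous (@dual_fun R Y : strong_dual Y -> F).
  exact: (@initial_continuous (dual Y) F).
have ceval : continuous (fun g : F => g x).
  move=> g W /nbhsP[E entE EW].
  have := fam_nbhs g entE (@tvs_bounded1 x); apply: filterS => h gh.
  by apply: EW; apply/xsectionP; exact: gh.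
move=> f; exact: (@continuous_comp (strong_dual Y) F R^o (@dual_fun R Y)
  (fun g => g x) f (cdual f) (ceval _)).
Qed.

Definition ev (x : Y) : dual (strong_dual Y) := Dual (ev_proof x).

Definition semireflexive := set_surj [set: Y] [set: dual (strong_dual Y)] ev.

End evaluation.

(* Main.v *)
Require Import Defs.
From HB Require Import structures.
From mathcomp Require Import all_boot all_order all_algebra.
From mathcomp Require Import all_classical all_reals.
From mathcomp Require Import topology normedtype convex.
From mathcomp Require Import derive lra.
Import numFieldTopology.Exports numFieldNormedType.Exports.
Local Open Scope classical_set_scope.
Local Open Scope ring_scope.

Set Implicit Arguments.
Unset Strict Implicit.
Unset Printing Implicit Defensive.
Import Order.TTheory GRing.Theory Num.Theory.

(** Let Y be X with the localized topology; it agrees with the topology of X on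
    each member of C.

    (A) => (B).  A neighborhood U of 0 in the strong dual of Y contains a
    multiple of the polar of some member of C, so by the bipolar theorem the
    polar of U lies in [ev @` D] for some D in C.  Since every form on the
    strong dual of Y is bounded by 1 on some U, [ev] is onto; it is one-to-one
    by the Hahn-Banach theorem.  On D, [ev] is a continuous injection from a
    compact space to a Hausdorff one, so its inverse is weak* continuous on the
    polar of U.

    (B) => (A).  For D in C, the bipolar of D is weak* compact by the
    Banach-Alaoglu theorem, hence compact for the localized weak* topology.
    Its inverse image under [ev] is therefore compact, and contains the closed
    set D. *)

(** * Hahn-Banach separation *)

Definition sublinear (R : realType) (X : lmodType R) (p : X -> R) :=
  [/\ p 0 <= 0, forall x y, p (x + y) <= p x + p y &
      forall t x, 0 < t -> p (t *: x) <= t * p x].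

Section hahn_banach.
Context (R : realType) (X : lmodType R).

(* Gauges, infima of chains of sublinear functions and the decrease step in
   the minimality argument are all of the form [inf \o S]. *)
Lemma sublinear_inf (S : X -> set R) :
  (forall x, has_inf (S x)) ->
  (forall e, 0 < e -> exists2 b, S 0 b & b <= e) ->
  (forall x y a b, S x a -> S y b -> exists2 c, S (x + y) c & c <= a + b) ->
  (forall t x a, 0 < t -> S x a -> exists2 b, S (t *: x) b & b <= t * a) ->
  sublinear (fun x => inf (S x)).
Proof.
move=> S_inf S0 SD SZ.
have infP x a b : S x b -> b <= a -> inf (S x) <= a.
  by move=> Sb; apply: le_trans; apply: ge_inf => //; case: (S_inf x).
split=> [|x y|t x t0].
- apply/ler_addgt0Pr => e e0; rewrite add0r.
  by have [b Sb be] := S0 _ e0; exact: infP be.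
- rewrite -lerBlDr; apply: lb_le_inf => [|a Sa]; first by case: (S_inf x).
  rewrite lerBlDr -lerBlDl; apply: lb_le_inf => [|b Sb].
    by case: (S_inf y).
  by rewrite lerBlDl; have [c Sc] := SD _ _ _ _ Sa Sb; exact: infP.
- rewrite -ler_pdivrMl//; apply: lb_le_inf => [|a Sa].
    by case: (S_inf x).
  by rewrite ler_pdivrMl//; have [c Sc] := SZ _ _ _ t0 Sa; exact: infP.
Qed.

Section sublinear_theory.
Variable p : X -> R.
Hypothesis sp : sublinear p.

Lemma sublinear0 : p 0 = 0.
Proof.
have [p0 pD _] := sp; apply/eqP; rewrite eq_le p0/=.
by have := pD 0 0; rewrite addr0 -subr_ge0 addrK.
Qed.

Lemma sublinearZ (t : R) x : 0 <= t -> p (t *: x) = t * p x.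
Proof.
rewrite le_eqVlt => /predU1P[<-|t0].
  by rewrite scale0r mul0r sublinear0.
have [_ _ pZ] := sp; apply/eqP; rewrite eq_le pZ//=.
rewrite -ler_pdivlMl//.
have := pZ t^-1 (t *: x); rewrite invr_gt0 => /(_ t0).
by rewrite scalerA mulVf ?gt_eqF// scale1r.
Qed.

Lemma sublinear_ge x : - p (- x) <= p x.
Proof.
have [_ pD _] := sp; rewrite lerNl -subr_ge0 opprK.
by have := pD (- x) x; rewrite addNr sublinear0.
Qed.

End sublinear_theory.

(* Witness: [x |-> inf_(t >= 0) (p (x + t *: y) - t * p y)]. *)
Lemma sublinear_decrease (p : X -> R) (y : X) : sublinear p ->
  exists2 s, sublinear s &
    forall x, s x <= p x /\ s x <= p (x + y) - p y.
Proof.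
move=> sp; have [_ pD _] := sp.
pose S x : set R := [set r | exists2 t, 0 <= t & r = p (x + t *: y) - t * p y].
have S_inf x : has_inf (S x).
  split; first by exists (p (x + 0 *: y) - 0 * p y), 0.
  exists (- p (- x)) => _ [t t0 ->].
  (* Subadditivity and homogeneity give [t * p y = p (t *: y) <= p (- x) + p (x + t *: y)]. *)
  by have := pD (- x) (x + t *: y); rewrite addKr sublinearZ//; lra.
have S_le x t : 0 <= t -> inf (S x) <= p (x + t *: y) - t * p y.
  by move=> t0; apply: ge_inf; [case: (S_inf x)|exists t].
exists (fun x => inf (S x)) => [|x].
  apply: sublinear_inf => //.
  - move=> e e0; exists 0; last exact: ltW.
    by exists 0; rewrite // scale0r addr0 mul0r subr0 sublinear0.
  - move=> x1 x2 _ _ [t1 t10 ->] [t2 t20 ->].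
    exists (p (x1 + x2 + (t1 + t2) *: y) - (t1 + t2) * p y).
      by exists (t1 + t2) => //; exact: addr_ge0.
    have := pD (x1 + t1 *: y) (x2 + t2 *: y).
    by rewrite addrACA -scalerDl; lra.
  - move=> t x _ t0 [s s0 ->].
    exists (p (t *: x + (t * s) *: y) - (t * s) * p y).
      by exists (t * s) => //; rewrite mulr_ge0// ltW.
    by rewrite -scalerA -scalerDr (sublinearZ sp _ (ltW t0)) mulrBr mulrA.
have := S_le x 1 ler01; rewrite scale1r mul1r; split=> //.
by have := S_le x 0 (lexx _); rewrite scale0r addr0 mul0r subr0.
Qed.

(** Decreasing [q] along [y] cannot go below [q], so [q x <= q (x + y) - q y]. This is
    superadditivity; additivity and oddness follow, and homogeneity extends to negative scalars. *)
Lemma minimal_sublinear_linear (q : X -> R) : sublinear q ->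
  (forall s, sublinear s -> (forall x, s x <= q x) -> forall x, q x <= s x) ->
  linear (q : X -> R^o).
Proof.
move=> sq qmin; have [_ qD _] := sq.
have q_add x y : q (x + y) = q x + q y.
  apply/eqP; rewrite eq_le qD/=.
  have [s ss sP] := sublinear_decrease y sq.
  have := qmin s ss (fun x => (sP x).1) x.
  by have [_] := sP x; lra.
have qN x : q (- x) = - q x.
  by apply/eqP; rewrite -subr_eq0 opprK -q_add addNr sublinear0.
move=> t x y; rewrite q_add; congr (_ + _).
have [t0|t0] := leP 0 t; first exact: sublinearZ.
rewrite -[t]opprK scaleNr qN sublinearZ ?oppr_ge0 1?ltW//.
by rewrite scaleNr; congr (- _).
Qed.

Lemma exists_minimal_sublinear (p : X -> R) : sublinear p ->
  exists2 q, sublinear q /\ (forall x, q x <= p x) &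
    forall s, sublinear s -> (forall x, s x <= q x) -> forall x, q x <= s x.
Proof.
move=> sp.
pose T := {q : X -> R | sublinear q /\ forall x, q x <= p x}.
(* The order is reversed: a maximal element for [le] is a minimal sublinear function, and a chain is
   bounded by its pointwise infimum. *)
pose le (q s : T) : bool := `[< forall x, sval s x <= sval q x >].
have p_T : sublinear p /\ forall x, p x <= p x by split.
have [||A Atot|[q [sq qp]] qmin] := @ZL_preorder T (exist _ p p_T) le.
- by move=> q; apply/asboolP.
- move=> q s r /asboolP qs /asboolP sr; apply/asboolP => x.
  exact: le_trans (sr x) (qs x).
- have [[q0 Aq0]|A0] := pselect (A !=set0); last first.
    by exists (exist _ p p_T) => s As; case: A0; exists s.
  pose S x : set R := [set sval q x | q in A].
  have lbS x : has_lbound (S x).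
    exists (- p (- x)) => _ [[q [sq qp]] Aq <-] /=.
    by rewrite (le_trans _ (sublinear_ge sq x))// lerN2.
  have sS : sublinear (fun x => inf (S x)).
    apply: sublinear_inf.
    - by move=> x; split => //; exists (sval q0 x), q0.
    - move=> e e0; exists (sval q0 0); first by exists q0.
      by rewrite (sublinear0 (svalP q0).1) ltW.
    - move=> x y _ _ [q Aq <-] [s As <-].
      have [/asboolP qs|/asboolP sq] := Atot _ _ Aq As.
        exists (sval s (x + y)); first by exists s.
        have [_ sD _] := (svalP s).1.
        by rewrite (le_trans (sD _ _))// lerD2r.
      exists (sval q (x + y)); first by exists q.
      have [_ qD _] := (svalP q).1.
      by rewrite (le_trans (qD _ _))// lerD2l.
    - move=> t x _ t0 [q Aq <-].
      exists (sval q (t *: x)); first by exists q.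
      by rewrite (sublinearZ (svalP q).1 _ (ltW t0)).
  have Sle x q : A q -> inf (S x) <= sval q x.
    by move=> Aq; apply: ge_inf => //; exists q.
  have Sp : sublinear (fun x => inf (S x)) /\ forall x, inf (S x) <= p x.
    by split=> // x; rewrite (le_trans (Sle x q0 Aq0))//; exact: (svalP q0).2.
  exists (exist _ (fun x => inf (S x)) Sp) => q Aq; apply/asboolP => x.
  exact: Sle.
- exists q => // s ss sle.
  have s_T : sublinear s /\ forall x, s x <= p x.
    by split=> // x; exact: le_trans (sle x) (qp x).
  by apply: asboolW; apply: (qmin (exist _ s s_T)); exact: asboolT.
Qed.

(** Before a minimal function is taken, [p] is decreased along [x0]. Then
    [q (- x0) <= p 0 - p x0 = - p x0], which forces [p x0 <= q x0]. *)
Lemma hahn_banach (p : X -> R) (x0 : X) : sublinear p ->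
  exists f : X -> R^o,
    [/\ linear f, forall x, f x <= p x & f x0 = p x0].
Proof.
move=> sp; have [s ss sP] := sublinear_decrease x0 sp.
have [q [sq qs] qmin] := exists_minimal_sublinear ss.
have lq := minimal_sublinear_linear sq qmin.
have qp x : q x <= p x := le_trans (qs x) (sP x).1.
exists q; split=> //; apply/eqP; rewrite eq_le qp/=.
have := le_trans (qs (- x0)) (sP (- x0)).2.
by have := sublinear_ge sq x0; rewrite addNr sublinear0//; lra.
Qed.

End hahn_banach.

Lemma linear_form_continuous (R : realType) (X : tvsType R) (f : X -> R^o)
    (U : set X) :
  linear f -> nbhs (0 : X) U -> (forall x, U x -> `|f x| <= 1) -> continuous f.
Proof.
move=> lf U0 fU x; pose F : {linear X -> R^o} := HB.pack f
  (GRing.isLinear.Build R X R^o *:%R f lf).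
apply/cvgrPdist_le => e e0.
have := nbhsT x (nbhs0Z (lt0r_neq0 e0) U0).
apply: filterS => _ [_ [u Uu <-] <-].
rewrite -[f]/(F : X -> R^o) linearD linearZ/= opprD addNKr normrN.
rewrite normrM gtr0_norm//.
by rewrite ler_piMr ?fU// ltW.
Qed.

(** The form is dominated by the gauge of a convex neighborhood [V] of 0 that misses [x], and equals
    it at [x], where the gauge is at least 1. *)
Lemma separating_form (R : realType) (X : tvsType R) (x : X) :
  hausdorff_space X -> x != 0 ->
  exists f : X -> R^o, [/\ linear f, continuous f & f x != 0].
Proof.
rewrite open_hausdorff => /[apply] -[[A U] /= [/set_mem Ax /set_mem U0]].
move=> [oA oU /eqP AU0].
have [B Bconv [Bopen Bnbhs]] := @locally_convex R X.
have [V [BV V0 VU]] := Bnbhs 0 U (open_nbhs_nbhs (conj oU U0)).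
have nV : nbhs 0 V by apply: open_nbhs_nbhs; split=> //; exact: Bopen.
have nVx : ~ V x by move=> /VU Ux; have : (A `&` U) x by []; rewrite AU0.
have /convex_setP cV := Bconv V (mem_set BV).
pose S y : set R := [set t | 0 < t /\ exists2 u, V u & y = t *: u].
have S_inf y : has_inf (S y).
  split; last by exists 0 => t [/ltW].
  have /(_ V nV) VE := @tvs_bounded1 R X y.
  have [r [/(_ _ erefl)[u Vu ruy] r0]] :=
    filter_ex (filterI VE (nbhs_pinfty_gt (num_real 0))).
  by exists r; split => //; exists u.
have sS : sublinear (fun y => inf (S y)).
  apply: sublinear_inf => //.
  - by move=> e e0; exists e => //; split=> //; exists 0 => //; rewrite scaler0.
  - move=> _ _ a b [a0 [u Vu ->]] [b0 [v Vv ->]].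
    have ab0 : 0 < a + b by exact: addr_gt0.
    exists (a + b) => //; split=> //.
    exists ((a / (a + b)) *: u + (1 - a / (a + b)) *: v).
      apply: cV => //; first by rewrite divr_ge0// ltW.
      by rewrite ler_pdivrMr// mul1r lerDl ltW.
    rewrite scalerDr !scalerA mulrBr mulr1 mulrCA mulfV ?gt_eqF// mulr1.
    by rewrite addrAC subrr add0r.
  - move=> t _ a t0 [a0 [u Vu ->]]; exists (t * a) => //.
    by split; [exact: mulr_gt0|exists u => //; rewrite scalerA].
have [f [lf fS fx]] := hahn_banach x sS.
have f_le1 u : V u -> f u <= 1.
  move=> Vu; apply: (le_trans (fS u)); apply: ge_inf; first by case: (S_inf u).
  by split=> //; exists u; rewrite // scale1r.
exists f; split=> //.
  (* [V] need not be symmetric, and [f] is bounded by 1 only from above on it; intersecting with its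
     opposite bounds [f] from below. *)
  apply: (@linear_form_continuous _ _ _ (V `&` -%R @` V)) => //.
    by apply: filterI => //; exact: nbhs0N.
  move=> u [Vu [v Vv vu]]; rewrite ler_norml f_le1// andbT.
  pose F : {linear X -> R^o} := HB.pack f
    (GRing.isLinear.Build R X R^o *:%R f lf).
  by rewrite -vu -[f]/(F : X -> R^o) linearN lerN2 f_le1.
rewrite fx gt_eqF// (lt_le_trans ltr01)//; apply: lb_le_inf.
  by case: (S_inf x).
(* A value [t < 1] would make [x] a convex combination of [u] and 0, hence a point of [V]. *)
move=> t [t0 [u Vu xtu]]; rewrite leNgt; apply/negP => t1; apply: nVx.
rewrite xtu -[_ *: _]addr0 -(scaler0 _ (1 - t)).
by apply: cV => //; exact: ltW.
Qed.

(** * Strong and weak* duals *)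

Lemma tvs_bounded0 (R : realType) (Y : preTopologicalLmodType R) :
  tvs_bounded (set0 : set Y).
Proof. by move=> U _; apply: nearW => r x. Qed.

Lemma tvs_boundedU (R : realType) (Y : preTopologicalLmodType R)
  (A B : set Y) : tvs_bounded A -> tvs_bounded B -> tvs_bounded (A `|` B).
Proof.
move=> bA bB U U0; apply: filterS2 (bA U U0) (bB U U0) => r Ar Br x.
by case=> [/Ar|/Br].
Qed.

Section strong_dual.
Context (R : realType) (Y : preTopologicalLmodType R).

Let unif_nbhs (f : Y -> R^o) (Be : set Y * R) : set (Y -> R^o) :=
  [set g | forall y, Be.1 y -> `|f y - g y| <= Be.2].

(** A single pair [(B, e)] suffices because bounded sets are stable under binary unions: the sets
    [unif_nbhs] form a filter base, and its filter [G] converges to [f] uniformly on each bounded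
    set. *)
Lemma strong_dual_nbhsP (f : strong_dual Y) (A : set (strong_dual Y)) :
  nbhs f A <-> exists (B : set Y) (e : R), [/\ tvs_bounded B, 0 < e &
    [set g : strong_dual Y | forall y, B y ->
      `|dual_fun f y - dual_fun g y| <= e] `<=` A].
Proof.
pose F := {family @tvs_bounded R Y, Y -> R^o}.
split=> [[_ [[O oO <-] /= Of OA]]|[B [e [bB e0 BA]]]].
  pose I : set (set Y * R) := [set Be | tvs_bounded Be.1 /\ 0 < Be.2].
  pose G := filter_from I (unif_nbhs (dual_fun f)).
  have FG : Filter G.
    apply: filter_from_filter.
      by exists (set0, 1); split=> //; exact: tvs_bounded0.
    move=> [B d] [C e] [/= bB d0] [/= bC e0].
    exists (B `|` C, Num.min d e) => [|g fg].
      by split=> /=; [exact: tvs_boundedU|rewrite lt_min d0].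
    by split=> y /= By; (apply: le_trans (fg y _) _ => /=;
      [by [left|right]|by rewrite ge_min lexx ?orbT]).
  have /(_ O) : G --> (dual_fun f : F).
    apply/fam_cvgP => B bB P /uniform_nbhs[E [entE EP]].
    have [e /= e0 eE] : entourage E := entE.
    exists (B, e / 2) => [|g fg]; first by split=> //=; exact: divr_gt0.
    apply: EP => y /fg /= fgy; apply: eE => /=.
    by rewrite (le_lt_trans fgy)// ltr_pdivrMr// ltr_pMr// ltr1n.
  case=> [|[B e] [bB e0] BO]; first exact: open_nbhs_nbhs.
  by exists B, e; split=> // g fg; apply: OA; exact: BO.
have entE : entourage [set xy : R^o * R^o | `|xy.1 - xy.2| <= e].
  by exists e => //= xy; exact: ltW.
apply: (@filterS _ (nbhs f) _ _ _ BA).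
have cdual := @initial_continuous (dual Y) F (@dual_fun R Y) f.
exact: (cdual _ (@fam_nbhs Y R^o (@tvs_bounded R Y) B _ (dual_fun f) entE bB)).
Qed.

End strong_dual.

Section weak_star_dual.
Context (R : realType) (Y : preTopologicalLmodType R).

Lemma weak_star_cvgP (F : set_system (weak_star_dual Y))
    (f : weak_star_dual Y) :
  Filter F ->
  F --> f <-> forall y,
    (fun g : weak_star_dual Y => dual_fun g y : R^o) @ F --> dual_fun f y.
Proof.
move=> FF; split=> [Ff y|Ff A [_ [[O oO <-] /= Of OA]]].
  have Ffy := cvg_app (fun g : weak_star_dual Y => dual_fun g y : R^o) Ff.
  apply: (cvg_trans Ffy).
  apply: (@continuous_comp (weak_star_dual Y) {ptws Y -> R^o} R^o
    (@dual_fun R Y) (fun g => g y)).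
    exact: (@initial_continuous (dual Y) {ptws Y -> R^o}).
  exact: (@proj_continuous Y (fun=> R^o) y).
(* The product topology is the supremum of the topologies induced by the coordinates, so convergence
   is tested one point [y] at a time. *)
have : @dual_fun R Y @ F --> (dual_fun f : {ptws Y -> R^o}).
  apply/cvg_sup => y; apply/cvg_image.
    by apply/seteqP; split=> // r _; exists (fun=> r).
  move=> B /Ff; rewrite /= => FB.
  exists ((fun g : Y -> R^o => g y) @^-1` B) => //.
  by rewrite image_preimage//; apply/seteqP; split=> // r _; exists (fun=> r).
move=> /(_ O (open_nbhs_nbhs (conj oO Of))) FO.
exact: (@filterS _ F FF _ _ OA FO).
Qed.

Lemma weak_star_eval_continuous (y : Y) :
  continuous (fun g : weak_star_dual Y => dual_fun g y : R^o).
Proof.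
by move=> f; have /(weak_star_cvgP f)/(_ y) : nbhs f --> f by exact: cvg_id.
Qed.

Lemma weak_star_continuous (T : topologicalType) (h : T -> weak_star_dual Y) :
  (forall y, continuous (fun t => dual_fun (h t) y : R^o)) -> continuous h.
Proof. by move=> ch t; apply/weak_star_cvgP => y; exact: ch. Qed.

Lemma weak_star_hausdorff : hausdorff_space (weak_star_dual Y).
Proof.
move=> f g fg; apply/val_inj/funext => y.
apply: (@Rhausdorff R) => A B /weak_star_eval_continuous fA.
move=> /weak_star_eval_continuous gB.
by have [h [Ah Bh]] := fg _ _ fA gB; exists (dual_fun h y).
Qed.

Lemma dual_linear (f : dual Y) : linear (dual_fun f).
Proof. by have /asboolP[] := dual_funP f. Qed.

Lemma dual_continuous (f : dual Y) : continuous (dual_fun f).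
Proof. by have /asboolP[] := dual_funP f. Qed.

HB.instance Definition _ (f : dual Y) :=
  GRing.isLinear.Build R Y R^o *:%R (dual_fun f) (dual_linear f).

(** Along an ultrafilter on the polar, the values at each point stay in a compact segment and
    converge; the pointwise limit is linear and bounded by 1 on [U]. The hypotheses state what is
    needed of a neighborhood [U] of 0, in a form that can be checked directly in a strong dual. *)
Lemma banach_alaoglu (U : set Y) :
  (forall y, exists2 t, t != 0 & U (t *: y)) ->
  (forall f : Y -> R^o, linear f -> (forall y, U y -> `|f y| <= 1) ->
    continuous f) ->
  compact (polar U : set (weak_star_dual Y)).
Proof.
move=> absU contU; rewrite compact_ultra => F FU FK.
pose ey y (f : weak_star_dual Y) : R^o := dual_fun f y.
have polF : \forall f \near F, forall y, U y -> `|ey y f| <= 1 by [].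
have l_ex y : exists l : R^o, ey y @ F --> l.
  have [t t0 Uty] := absU y.
  have [|l [_ Fl]] := @segment_compact R (- `|t|^-1) `|t|^-1 (ey y @ F).
    apply: filterS polF => f /(_ _ Uty).
    rewrite /= /ey linearZ normrM mulrC -ler_pdivlMr ?normr_gt0// div1r.
    by rewrite in_itv/= -ler_norml.
  (* An ultrafilter converges to its cluster point [l]: otherwise it would contain the preimage of
     the complement of a neighborhood of [l]. *)
  exists l => B nB; have [//|FnB] := in_ultra_setVsetC (ey y @^-1` B) FU.
  by have [r []] := Fl (~` B) B FnB nB.
have [l Fl] := choice l_ex.
have ll : linear (l : Y -> R^o).
  move=> a x y; apply: (cvg_unique (@Rhausdorff R) (Fl _)).
  rewrite (_ : ey _ = fun f => a *: ey x f + ey y f).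
    by apply: cvgD => //; exact: cvgZl_tmp.
  by apply/funext => f; rewrite /ey linearP.
have lU y : U y -> `|l y| <= 1.
  move=> Uy; have /cvg_norm Fly := Fl y.
  apply: (cvgr_to_le Fly).
  by apply: filterS polF => f; exact.
have dl : (l : Y -> R^o) \in @continuous_form R Y.
  by apply/asboolP; split => //; exact: contU.
exists (Dual dl : weak_star_dual Y); split; first exact: lU.
exact/weak_star_cvgP.
Qed.

End weak_star_dual.

(** * Bipolars of compact sets *)

Section bipolar.
Context (R : realType) (Y : tvsType R).

Let form_lincomb (s : seq (strong_dual Y)) (a : strong_dual Y -> R)
    (phi : dual (strong_dual Y)) :
  dual_fun phi (\sum_(f <- s) a f *: f) = \sum_(f <- s) a f * dual_fun phi f.
Proof.
by rewrite linear_sum; apply: eq_bigr => f _; rewrite linearZ.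
Qed.

(* The minimizer over D of the sum of the squares of [phi f - f x] solves the
   equations [f x = phi f]: its residuals, taken as coefficients, define a form
   whose maximum over D is attained there. *)
Lemma bipolar_finite (D : set Y) (phi : dual (strong_dual Y))
    (s : seq (strong_dual Y)) :
  compact D -> absolutely_convex D -> D !=set0 ->
  polar (polar D : set (strong_dual Y)) phi ->
  exists2 x, D x & forall f, f \in s -> dual_fun f x = dual_fun phi f.
Proof.
move=> Dcpt [/convex_setP Dconv Dbal] D0 Dphi.
pose N x : R := \sum_(f <- s) (dual_fun phi f - dual_fun f x) ^+ 2.
have cN : continuous N.
  apply: continuous_big => [|f _ x]; first exact: (@add_continuous R^o).
  have cf : dual_fun phi f - dual_fun f y @[y --> x] -->
      dual_fun phi f - dual_fun f x.
    by apply: (@cvgB _ R^o); [exact: cvg_cst|exact: dual_continuous].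
  exact: (cvgM cf cf).
have [x0 /set_mem Dx0 Nmin] :=
  compact_EVT_min D0 Dcpt (continuous_subspaceT cN).
pose a (f : strong_dual Y) : R := dual_fun phi f - dual_fun f x0.
pose g : strong_dual Y := \sum_(f <- s) a f *: f.
have gE x : dual_fun g x = \sum_(f <- s) a f * dual_fun f x.
  exact: (@form_lincomb s a (ev x)).
have g_max x : D x -> dual_fun g x <= dual_fun g x0.
  have gB : dual_fun g x - dual_fun g x0 = dual_fun g (x - x0).
    by rewrite linearB.
  move=> Dx; rewrite -subr_le0 gB leNgt; apply/negP.
  pose d f : R := dual_fun f (x - x0).
  pose b := \sum_(f <- s) d f ^+ 2.
  have b0 : 0 <= b by apply: sumr_ge0 => f _; exact: sqr_ge0.
  rewrite gE -/d => u0; set u := \sum_(f <- s) _ in u0.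
  (* Along the segment from [x0] to [x], [N] has slope [-2 u] at [t = 0], where [u = g (x - x0)]. *)
  have Nt t : N (t *: x + (1 - t) *: x0) = N x0 - t *+ 2 * u + t ^+ 2 * b.
    rewrite /N /u /b !mulr_sumr -sumrB -big_split/=; apply: eq_bigr => f _.
    by rewrite /a /d !linearD !linearZ linearN/= /GRing.scale/=; lra.
  have uv0 : 0 < u + b + 1 by lra.
  (* This [t] is at most 1 and satisfies [t * b <= u], so the increment [- 2 t u + t ^ 2 b] is
     negative, against the minimality of [N x0]. *)
  pose t := u / (u + b + 1).
  have t0 : 0 < t by rewrite divr_gt0.
  have t1 : t <= 1 by rewrite ler_pdivrMr//; lra.
  have := Nmin (t *: x + (1 - t) *: x0).
  rewrite inE => /(_ (Dconv _ _ _ (ltW t0) t1 Dx Dx0)).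
  have tE : t * (u + b + 1) = u by rewrite mulfVK// gt_eqF.
  by rewrite Nt; nra.
have g_abs x : D x -> `|dual_fun g x| <= dual_fun g x0.
  move=> Dx; rewrite ler_norml g_max// andbT lerNl -linearN g_max//.
  by rewrite -scaleN1r; apply: Dbal => //; rewrite normrN1.
have phig : dual_fun phi g <= dual_fun g x0.
  (* The maximum [g x0] may be 0, so [g] is divided by [g x0 + e] to land in the polar of [D]. *)
  apply/ler_addgt0Pr => e e0.
  have c0 : 0 < dual_fun g x0 + e.
    by rewrite ltr_wpDl// (le_trans _ (g_abs _ Dx0)).
  have := Dphi ((dual_fun g x0 + e)^-1 *: g) _.
  rewrite linearZ normrM gtr0_norm ?invr_gt0// ler_pdivrMl// mulr1.
  move=> H; apply: le_trans (ler_norm _) (H _) => x Dx.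
  rewrite -[dual_fun _ x]/(dual_fun (ev x) (_ *: g)) linearZ normrM.
  rewrite gtr0_norm ?invr_gt0// ler_pdivrMl// mulr1.
  by rewrite (le_trans (g_abs _ Dx))// lerDl ltW.
(* [phi g - g x0] is the sum of the [a f * (phi f - f x0)], which is [N x0]; so [phig] says that
   [N x0 <= 0]. *)
have N0 : N x0 = 0.
  apply/eqP; rewrite eq_le sumr_ge0 ?andbT => [|f _]; last exact: sqr_ge0.
  move: phig; rewrite form_lincomb gE -subr_le0 -sumrB; congr (_ <= _).
  by apply: eq_bigr => f _; rewrite -mulrBr.
exists x0 => // f sf; apply/eqP; rewrite eq_sym -subr_eq0 -sqrf_eq0.
move/eqP: N0; rewrite psumr_eq0 => [|h _]; last exact: sqr_ge0.
by move=> /allP/(_ f sf).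
Qed.

(** By [bipolar_finite] the sets [A s], where [phi] agrees with evaluation on the finite list [s],
    generate a proper filter. By continuity of each form, [phi] is evaluation at any cluster point
    of this filter in [D]. *)
Lemma bipolar (D : set Y) :
  compact D -> absolutely_convex D -> D !=set0 ->
  polar (polar D : set (strong_dual Y)) `<=` ev (Y := Y) @` D.
Proof.
move=> Dcpt Dac D0 phi Dphi.
pose A (s : seq (strong_dual Y)) := [set x | D x /\
  forall f, f \in s -> dual_fun f x = dual_fun phi f].
have FA : ProperFilter (filter_from setT A).
  apply: filter_from_proper.
    apply: filter_from_filter; first by exists [::].
    move=> s t _ _; exists (s ++ t) => // x [Dx xst].
    by split; split=> // f ft; apply: xst; rewrite mem_cat ft ?orbT.
  move=> s _; have [x Dx xs] := bipolar_finite s Dcpt Dac D0 Dphi.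
  by exists x.
have [|x [Dx Fx]] := Dcpt _ FA; first by exists [::] => // x [].
exists x => //; apply/val_inj/funext => f /=.
apply: (@Rhausdorff R) => P Q /dual_continuous fP /nbhs_singleton Qf.
have [|z [[_ zf] /= Pz]] := Fx (A [:: f]) _ _ fP; first by exists [:: f].
by exists (dual_fun f z); split=> //; rewrite zf ?mem_head.
Qed.

End bipolar.

(** * Localizations *)

Section localization_theory.
Context (R : realType) (X : preTopologicalLmodType R) (C : set_system X).

(** The convex witnesses vary with the point of [E], but each has an open trace on [D]. The union of
    all open sets whose trace on [D] lies in [E] collects them without choice. *)
Lemma localized_open_relative (E : set X) :
  localized_open C E -> relatively_open C E.
Proof.
move=> oE D CD; exists (\bigcup_(O in [set O | open O /\ O `&` D `<=` E]) O).
  by apply: bigcup_open => O [].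
apply/seteqP; split=> x [].
  move=> /oE[V [_ Vx VE /(_ D CD)[O oO VO]]] Dx; split=> //.
  have [Ox _] : (O `&` D) x by rewrite -VO.
  by exists O => //; split=> // y; rewrite -VO => -[/VE].
by move=> [O [_ OE] Ox] Dx; split=> //; exact: OE.
Qed.

(** A cluster point in [K] for [X] remains one for the localization, whose open sets have relatively
    open traces on [D]. *)
Lemma compact_localization (D K : set X) : C D -> K `<=` D ->
  compact K -> compact (K : set (localization C)).
Proof.
move=> CD KD cK F FF FK; have [x [Kx Fx]] := cK F FF FK.
exists x; split=> // A B FA [E [oE Ex EB]].
have [O oO EO] := localized_open_relative oE CD.
have [Ox _] : (O `&` D) x by rewrite -EO; split=> //; exact: KD.
have [y [[Ay Ky] Oy]] :=
  Fx _ _ (filterI FA FK) (open_nbhs_nbhs (conj oO Ox)).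
exists y; split=> //; apply: EB.
by have [] : (E `&` D) y by rewrite EO; split=> //; exact: KD.
Qed.

End localization_theory.

Section localization_tvs_theory.
Context (R : realType) (X : tvsType R) (C : set_system X).

Lemma open_localization (O : set X) : open O -> localized_open C O.
Proof.
move=> oO x Ox; have [B Bconv [Bopen Bnbhs]] := @locally_convex R X.
have [V [BV Vx VO]] := Bnbhs x O (open_nbhs_nbhs (conj oO Ox)).
exists V; split=> //; first exact: Bconv (mem_set BV).
by move=> D _; exists V => //; exact: Bopen.
Qed.

Lemma localization_id_continuous : continuous (id : localization C -> X).
Proof. by apply/continuousP => O /open_localization. Qed.

End localization_tvs_theory.

(** * Polars in the strong dual and the evaluation map *)

Section bounded_weak_star.
Context (R : realType) (Y : tvsType R).

Section polar_bounded.
Variable B : set Y.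
Hypothesis bB : tvs_bounded B.

Lemma polar_nbhs : nbhs (0 : strong_dual Y) (polar B : set (strong_dual Y)).
Proof.
apply/strong_dual_nbhsP; exists B, 1; split=> // f f1 y /f1.
by rewrite sub0r normrN.
Qed.

(** The set where [f] is bounded by 1 is a neighborhood of 0, hence absorbs [B]. This lemma and the
    next one supply the hypotheses of [banach_alaoglu]. *)
Lemma polar_absorbing (f : strong_dual Y) :
  exists2 t : R, t != 0 & (polar B : set (strong_dual Y)) (t *: f).
Proof.
have /cvgrPdist_le/(_ 1 ltr01) := @dual_continuous R Y f 0.
move=> /bB BE; have [r [Br r0]] :=
  filter_ex (filterI BE (nbhs_pinfty_gt (num_real 0))).
exists r^-1; first by rewrite invr_eq0 gt_eqF.
move=> _ /Br[u /= fu <-]; rewrite linear0 sub0r normrN in fu.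
(* Linearity in the form, as opposed to the point, is that of [ev]. *)
change (`|dual_fun (ev (Y := Y) (r *: u)) (r^-1 *: f)| <= 1).
rewrite linearZ; change (`|r^-1 *: (dual_fun f (r *: u) : R^o)| <= 1).
by rewrite linearZ scalerA mulVf ?gt_eqF// scale1r.
Qed.

Lemma bounded_on_polar_continuous (F : strong_dual Y -> R^o) : linear F ->
  (forall f, (polar B : set (strong_dual Y)) f -> `|F f| <= 1) -> continuous F.
Proof.
move=> lF FB f.
apply/(@cvgrPdist_le _ R^o _ (nbhs f) (nbhs_filter f)) => e e0.
apply/strong_dual_nbhsP; exists B, e; split=> // g fg.
pose G : {linear strong_dual Y -> R^o} := HB.pack F
  (GRing.isLinear.Build R (strong_dual Y) R^o *:%R F lF).
have /FB : (polar B : set (strong_dual Y)) (e^-1 *: (f - g)).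
  move=> y By.
  rewrite -[dual_fun _ _]/(dual_fun (ev (Y := Y) y) (e^-1 *: (f - g))).
  rewrite linearZ linearB normrM gtr0_norm ?invr_gt0// ler_pdivrMl// mulr1.
  exact: fg.
rewrite -[F]/(G : _ -> _) linearZ linearB normrM gtr0_norm ?invr_gt0//.
by rewrite ler_pdivrMl// mulr1.
Qed.

End polar_bounded.

Lemma ev_linear_combination (a b : R) (x y : Y) :
  ev (a *: x + b *: y) = a *: ev x + b *: ev y.
Proof.
apply: val_inj; rewrite linearD !linearZ; apply/funext => f /=.
change (dual_fun f (a *: x + b *: y) =
  a *: (dual_fun f x : R^o) + b *: (dual_fun f y : R^o)).
by rewrite linearD !linearZ.
Qed.

Lemma ev_weak_star_continuous :
  continuous (ev (Y := Y) : Y -> weak_star_dual (strong_dual Y)).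
Proof. by apply: weak_star_continuous => f; exact: dual_continuous. Qed.

End bounded_weak_star.

(** * The evaluation map of a localized space *)

Section evaluation_localization.
Context (R : realType) (X : tvsType R) (C : localizing_family X).
Let Y : tvsType R := localization_tvsType C.
Hypothesis C_bounded : forall E : set (localization C),
    tvs_bounded E <-> exists2 D : set X, lf_sets C D & E `<=` D.
Hypothesis C_abs_convex : forall D : set X, lf_sets C D -> absolutely_convex D.

(** A form separating points of [X] stays continuous for the finer localized topology. *)
Lemma ev_inj : hausdorff_space X -> injective (ev (Y := Y)).
Proof.
move=> hX x y exy; apply/eqP; rewrite -subr_eq0; apply/negPn/negP => xy0.
have [f [lf cf]] := separating_form hX xy0; apply/negP/negPn.
have df : (f : Y -> R^o) \in @continuous_form R Y.
  apply/asboolP; split=> // z.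
  apply: (@continuous_comp Y X R^o id f); last exact: cf.
  exact: localization_id_continuous.
have fxy : f x = f y :=
  congr1 (fun phi : dual (strong_dual Y) => dual_fun phi (Dual df)) exy.
by rewrite addrC -scaleN1r lf fxy scaleN1r addNr.
Qed.

Lemma polar_sub_ev (U : set (strong_dual Y)) :
  (forall D : set X, lf_sets C D -> compact D) -> nbhs (0 : strong_dual Y) U ->
  exists2 D : set X, lf_sets C D & polar U `<=` ev (Y := Y) @` D.
Proof.
move=> Ccpt /strong_dual_nbhsP[B [e [/C_bounded[D1 CD1 BD1] e0 BU]]].
(* With [D] containing [e^-1 *: D1], every form in the polar of [D] is bounded by [e] on [B], hence
   lies in [U]; so the polar of [U] is within the bipolar of [D]. *)
have [_ C0 /(_ D1 0 e^-1 CD1)[D CD D1D]] := lf_localizing C.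
exists D => // phi phiU.
have Dcpt : compact (D : set Y).
  exact: compact_localization CD (@subset_refl _ D) (Ccpt _ CD).
apply: (bipolar Dcpt (C_abs_convex CD)); first by exists 0; exact: (C0 _ CD).2.
move=> f f1; apply: phiU; apply: BU => y /BD1 D1y; rewrite sub0r normrN.
have /f1 : D (e^-1 *: y) by apply: D1D; exists y; rewrite // add0r.
rewrite -[e^-1 *: y]/(e^-1 *: (y : Y)) linearZ normrM.
by rewrite gtr0_norm ?invr_gt0// ler_pdivrMl// mulr1.
Qed.

(** Only traces on members [D] of [C] matter. There [ev] takes values in the bipolar of [D], on
    which the set [V] is the trace of a weak* open set, and [ev] is weak* continuous. *)
Lemma ev_continuous :
  continuous (ev (Y := Y) : Y -> bounded_weak_star_dual (strong_dual Y)).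
Proof.
apply/continuousP => A oA; change (localized_open C (ev (Y := Y) @^-1` A)).
have {}oA : @localized_open R (weak_star_dual (strong_dual Y))
    [set polar U | U in nbhs (0 : strong_dual Y)] A := oA.
move=> x Ax; have [V [/convex_setP cV Vx VA oV]] := oA _ Ax.
exists (ev (Y := Y) @^-1` V); split=> //.
- apply/convex_setP => y z l l0 l1 /= Vy Vz.
  rewrite -[_ + _]/(l *: (y : Y) + (1 - l) *: (z : Y)).
  by rewrite ev_linear_combination; apply: cV.
- by move=> y /VA.
move=> D CD; pose U : set (strong_dual Y) := polar (D : set Y).
have nU : nbhs 0 U by apply: polar_nbhs; apply/C_bounded; exists D.
have [O oO VO] := oV (polar U) (ex_intro2 _ _ U nU erefl).
have /continuousP/(_ O oO) oevO := @ev_weak_star_continuous R Y.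
(* The preimage of [O] is open for the localized topology; on [D] this is the trace of an open set
   of [X]. *)
have [P oP OP] := localized_open_relative oevO CD.
exists P => //; rewrite -OP; apply/seteqP; split=> y [/= Vy Dy]; split=> //.
- have : (V `&` polar U) (ev (Y := Y) y) by split=> // f /(_ _ Dy).
  by rewrite VO => -[].
- have : (O `&` polar U) (ev (Y := Y) y) by split=> // f /(_ _ Dy).
  by rewrite -VO => -[].
Qed.

Lemma ev_inverse_continuous (g : dual (strong_dual Y) -> Y) :
  (forall D : set X, lf_sets C D -> compact D) ->
  cancel (ev (Y := Y)) g -> cancel g (ev (Y := Y)) ->
  continuous (g : bounded_weak_star_dual (strong_dual Y) -> Y).
Proof.
move=> Ccpt evK gK; apply/continuousP => A oA.
change (@localized_open R (weak_star_dual (strong_dual Y))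
    [set polar U | U in nbhs (0 : strong_dual Y)] (g @^-1` A)).
have {}oA : localized_open C A := oA.
move=> phi Aphi.
have [V [/convex_setP cV Vx VA oV]] := oA _ Aphi.
exists (g @^-1` V); split=> //.
- apply/convex_setP => y z l l0 l1 /= Vy Vz.
  have -> : l *: y + (1 - l) *: z = ev (l *: g y + (1 - l) *: g z).
    by rewrite ev_linear_combination !gK.
  by rewrite evK; exact: cV.
- by move=> y /VA.
move=> _ [U nU <-]; have [D CD UD] := polar_sub_ev Ccpt nU.
have [O oO VO] := oV D CD.
(* The preimage of [V] by [g] is its image by [ev]. Within the polar of [U], contained in the image
   of [D], its complement comes from the compact set [D] minus [O], whose image is weak* compact and
   therefore closed. *)
exists (~` (ev (Y := Y) @` (D `&` ~` O))).
  apply: closed_openC; apply: compact_closed; first exact: weak_star_hausdorff.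
  apply: (@continuous_compact Y (weak_star_dual (strong_dual Y)) (ev (Y := Y))).
    by apply: continuous_subspaceT; exact: ev_weak_star_continuous.
  apply: (compact_localization CD); first by move=> x [].
  apply: compact_closedI; first exact: Ccpt.
  exact: open_closedC.
apply/seteqP; split=> psi [/= Hpsi Upsi]; split=> //;
  have [x Dx xpsi] := UD _ Upsi.
- move=> [y [Dy nOy] ypsi]; apply: nOy.
  have : (V `&` D) y by split=> //; rewrite -(evK y) ypsi.
  by rewrite VO => -[].
- rewrite -xpsi in Hpsi *; rewrite /= evK; have : (O `&` D) x.
    by split=> //; apply: contrapT => nOx; apply: Hpsi; exists x.
  by rewrite -VO => -[].
Qed.

Lemma compact_of_ev_homeomorphism (D : set X) :
  homeomorphism (ev (Y := Y) : Y -> bounded_weak_star_dual (strong_dual Y)) ->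
  lf_sets C D -> closed D -> compact D.
Proof.
move=> [g [evK gK _ cg]] CD clD.
pose U : set (strong_dual Y) := polar (D : set Y).
have bD : tvs_bounded (D : set Y) by apply/C_bounded; exists D.
have nU : nbhs 0 U by exact: polar_nbhs.
have Kcpt : compact (polar U : set (weak_star_dual (strong_dual Y))).
  apply: banach_alaoglu; first exact: polar_absorbing.
  exact: bounded_on_polar_continuous.
have Kcpt' : compact (polar U : set (bounded_weak_star_dual (strong_dual Y))).
  by apply: (compact_localization _ (@subset_refl _ _) Kcpt); exists U.
(* The inverse image of the bipolar under [ev] is its image under the continuous inverse [g],
   followed by the continuous identity to [X]. *)
apply: (@subclosed_compact X D (g @` polar U) clD).
  rewrite -[g]/((id : localization C -> X) \o g).
  apply: continuous_compact Kcpt'.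
  apply: continuous_subspaceT => phi.
  apply: (@continuous_comp _ Y X); first exact: cg.
  exact: localization_id_continuous.
by move=> x Dx; exists (ev (Y := Y) x); [move=> f /(_ _ Dx)|exact: evK].
Qed.

End evaluation_localization.

Theorem theorem7p4 (R : realType) (X : tvsType R) (C : localizing_family X)
  (X_hausdorff : hausdorff_space X)
  (C_countable : nondecreasing_countable C)
  (C_abs_convex : forall D : set X, lf_sets C D -> absolutely_convex D)
  (C_closed : forall D : set X, lf_sets C D -> closed D)
  (C_bounded : forall E : set (localization C),
    tvs_bounded E <-> exists2 D : set X, lf_sets C D & E `<=` D) :
  (forall D : set X, lf_sets C D -> compact D) <->
  (semireflexive (localization C) /\
   homeomorphism (ev (Y := localization C) :
     localization C -> bounded_weak_star_dual (strong_dual (localization C)))).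
Proof.
pose Y : tvsType R := localization_tvsType C.
split=> [Ccpt|[_ hev] D CD]; last first.
  exact: (compact_of_ev_homeomorphism C_bounded hev CD (C_closed D CD)).
have ev_surj (phi : dual (strong_dual Y)) : exists x, ev (Y := Y) x = phi.
  have /cvgrPdist_le/(_ 1 ltr01) := @dual_continuous R (strong_dual Y) phi 0.
  move=> /(polar_sub_ev C_bounded C_abs_convex Ccpt)[D _ /(_ phi)[]].
    by move=> f /=; rewrite linear0 sub0r normrN.
  by move=> x _; exists x.
have [g gK] := choice ev_surj.
split; first by move=> phi _; exists (g phi).
have evK : cancel (ev (Y := Y)) g by move=> x; apply: (ev_inj X_hausdorff).
exists g; split=> //.
  exact: (ev_continuous C_bounded).
exact: (ev_inverse_continuous C_bounded C_abs_convex).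
Qed.
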